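(* Let $G=(V,E)$ be a finite simple connected graph and let $k$ be an integer with $0\leq k<\Delta(G)$. A nonempty set $S\subseteq V$ is an ultra $k$-secure set if and only if $$|N[X]\cap S|\;\geq\; k|X|+\sum_{x\in X}|N[x]-S|\qquad\text{for all } X\subseteq Bord(S).$$
   Context: All graphs are finite, simple and connected. $\Delta(G)$ is the maximum degree; $N[x]$ is the closed neighborhood of $x$ and $N[X]=\bigcup_{x\in X}N[x]$. For nonempty $S\subseteq V$: $Bord(S)=\{x\in S: N[x]-S\neq\emptyset\}$ and $\partial S=N[S]-S$. For a nonempty proper subset $S$ of $V$: an attack on $S$ is a function $A:\partial S\to Bord(S)$ such that each $x\in\partial S$ is adjacent to $A(x)$; a defense of $S$ is a function $D:N[Bord(S)]\cap S\to Bord(S)$ such that for each $y$ in the domain, $D(y)=y$ or $D(y)$ is adjacent to $y$. For $0\le k<\Delta(G)$, a defense $D$ of $S$ is an ultra $k$-defense if for every attack $A$ on $S$, $|D^{-1}(x)|-|A^{-1}(x)|\geq k$ for all $x\in Bord(S)$. A nonempty set $S\subseteq V$ is an ultra $k$-secure set if $S=V$ or $S$ has an ultra $k$-defense. *)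

(* Defs.v *)
From mathcomp Require Import all_boot all_order all_algebra.

Set Implicit Arguments.
Unset Strict Implicit.
Unset Printing Implicit Defensive.

Definition simple_connected_graph (T : finType) (e : rel T) : Prop :=
  [/\ symmetric e, irreflexive e & forall x y : T, connect e x y].

Definition max_degree (T : finType) (e : rel T) : nat :=
  \max_(x : T) #|[set y | e x y]|.

Definition cnbhd (T : finType) (e : rel T) (x : T) : {set T} :=
  [set y | (y == x) || e x y].

Definition cnbhds (T : finType) (e : rel T) (X : {set T}) : {set T} :=
  \bigcup_(x in X) cnbhd e x.

Definition Bord (T : finType) (e : rel T) (S : {set T}) : {set T} :=
  [set x in S | cnbhd e x :\: S != set0].

Definition bdry (T : finType) (e : rel T) (S : {set T}) : {set T} :=
  cnbhds e S :\: S.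

Definition defense_dom (T : finType) (e : rel T) (S : {set T}) : {set T} :=
  cnbhds e (Bord e S) :&: S.

(* Functions with domain a subset of T are represented by total functions
   T -> T whose values outside the domain are irrelevant; accordingly fibres
   must be taken inside the domain. *)
Definition fiber (T : finType) (dom : {set T}) (f : T -> T) (x : T) : {set T} :=
  [set y in dom | f y == x].

Definition is_attack (T : finType) (e : rel T) (S : {set T}) (A : T -> T) :
    Prop :=
  forall x, x \in bdry e S -> A x \in Bord e S /\ e x (A x).

Definition is_defense (T : finType) (e : rel T) (S : {set T}) (D : T -> T) :
    Prop :=
  forall y, y \in defense_dom e S ->
    D y \in Bord e S /\ (D y = y \/ e y (D y)).

(* The difference is taken in int, since subtraction on nat is truncated. *)
Definition ultra_defense (T : finType) (e : rel T) (k : nat) (S : {set T})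
    (D : T -> T) : Prop :=
  is_defense e S D /\
  forall A : T -> T, is_attack e S A ->
  forall x, x \in Bord e S ->
    (k%:Z <= #|fiber (defense_dom e S) D x|%:Z
             - #|fiber (bdry e S) A x|%:Z)%R.

Definition ultra_secure (T : finType) (e : rel T) (k : nat) (S : {set T}) :
    Prop :=
  S != set0 /\ (S = setT \/ exists D : T -> T, ultra_defense e k S D).

(* Main.v *)
Require Import Defs.
From mathcomp Require Import all_boot all_order all_algebra.
From mathcomp Require Import zify.

(** The theorem is Hall's marriage theorem with demands, read on the bipartite
    graph that joins a border vertex [x] to the vertices of [N[x] :&: S].

    Against one attack a defense only has to beat the number of attackers
    actually sent to [x], but it must resist all attacks, and some attack sends
    every vertex of [N[x] :\: S] to [x] (lemma [attack_concentrated]).  So being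
    an ultra [k]-defense means that each border vertex [x] receives at least
    [k + #|N[x] :\: S|] defenders, one vertex at a time.  Summing over [X] and
    using that fibres of a defense are disjoint subsets of [N[X] :&: S] gives
    the inequality.

    Conversely the inequality is Hall's condition for the demands
    [k + #|N[x] :\: S|], so [hall_demands] yields pairwise disjoint sets of
    defenders of the required sizes; the vertices left over may be sent to any
    border vertex in their reach.

    [hall_demands] follows Rado's pruning argument: delete elements from the
    sets [F x] as long as Hall's condition survives.  When no deletion is
    possible, each element of [F x] is protected by a tight set containing [x];
    since tight sets are closed under intersection, a single smallest tight set
    protects all of [F x] at once, and this forces [F x] to have exactly the
    demanded size.  Hall's condition for pairs then makes the sets disjoint. *)

(** * Hall's theorem with demands *)

Section Hall.

Set Implicit Arguments.
Unset Strict Implicit.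

Variables (I U : finType) (d : I -> nat).
Implicit Types (F H : I -> {set U}) (X Z : {set I}).

Definition hall_condition F :=
  [forall X : {set I}, \sum_(x in X) d x <= #|\bigcup_(x in X) F x|].

Definition tight F Z := #|\bigcup_(x in Z) F x| == \sum_(x in Z) d x.

(** Submodularity: [Z |-> #|\bigcup_(x in Z) F x|] is submodular while the
    total demand is modular, and tight sets are the minimizers, with value 0,
    of their nonnegative difference. *)
Lemma tightI F Z1 Z2 :
  hall_condition F -> tight F Z1 -> tight F Z2 -> tight F (Z1 :&: Z2).
Proof.
move=> /forallP hallF /eqP t1 /eqP t2.
have dUI : \sum_(x in Z1 :|: Z2) d x + \sum_(x in Z1 :&: Z2) d x =
           \sum_(x in Z1) d x + \sum_(x in Z2) d x.
  rewrite (big_setID Z1) /= setUK setDUl setDv set0U.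
  by rewrite [in RHS](big_setID Z1 (A := Z2)) /= setIC; lia.
have subI : \bigcup_(x in Z1 :&: Z2) F x \subset
    (\bigcup_(x in Z1) F x) :&: (\bigcup_(x in Z2) F x).
  apply/bigcupsP=> x /setIP[x1 x2].
  by rewrite subsetI !bigcup_sup.
have := subset_leq_card subI.
have := cardsUI (\bigcup_(x in Z1) F x) (\bigcup_(x in Z2) F x).
have := hallF (Z1 :|: Z2); have := hallF (Z1 :&: Z2).
rewrite bigcup_setU /tight => *; lia.
Qed.

Definition prune F x u : I -> {set U} :=
  fun y => if y == x then F x :\ u else F y.

Lemma prune_sub F x u y : prune F x u y \subset F y.
Proof. by rewrite /prune; case: eqP => // ->; apply: subD1set. Qed.

(** A deletion shrinks a union by at most one element, so a violation created
    at [Z] means that there was no slack at [Z] and that the union over [Z]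
    really lost [u]. *)
Lemma prune_tight F x u :
    hall_condition F -> ~~ hall_condition (prune F x u) ->
  exists Z, [/\ x \in Z, tight F Z & u \notin \bigcup_(y in Z :\ x) F y].
Proof.
move=> /forallP hallF; rewrite negb_forall => /existsP[Z].
rewrite -ltnNge => ltZ; have leZ := hallF Z; exists Z.
have subF : \bigcup_(y in Z) F y \subset
    u |: \bigcup_(y in Z) prune F x u y.
  apply/bigcupsP=> y Zy; apply/subsetP=> v Fyv; rewrite in_setU1.
  case: (eqVneq v u) => //= neq_vu; apply/bigcupP; exists y => //.
  by rewrite /prune; case: eqP Fyv => // -> ?; rewrite in_setD1 neq_vu.
have card_le := subset_leq_card subF; rewrite cardsU1 in card_le.
split; last 2 first.
- by rewrite /tight; apply/eqP; case: (_ \notin _) card_le => /=; lia.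
- have : u \notin \bigcup_(y in Z) prune F x u y.
    by case: (_ \notin _) card_le => //=; lia.
  apply: contra => /bigcupP[y /setD1P[neq_yx Zy] Fyu].
  by apply/bigcupP; exists y; rewrite // /prune (negPf neq_yx).
apply: contraLR ltZ => notZx; rewrite -leqNgt.
suff -> : \bigcup_(y in Z) prune F x u y = \bigcup_(y in Z) F y by [].
apply: eq_bigr => y Zy; rewrite /prune ifN //.
by apply: contraNneq notZx => <-.
Qed.

(** If nothing can be deleted from [F x], the smallest tight set [Z] containing
    [x] witnesses it for all elements of [F x] simultaneously, so [F x] is
    disjoint from the union over [Z :\ x]. *)
Lemma pruned_card F x :
    hall_condition F ->
    (forall u, u \in F x -> ~~ hall_condition (prune F x u)) ->
  #|F x| = d x.
Proof.
move=> hallF noprune; apply/eqP; rewrite eqn_leq andbC.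
have := forallP hallF [set x]; rewrite !big_set1 => -> /=.
have [->|[u0 Fu0]] := set_0Vmem (F x); first by rewrite cards0.
have [Z0 [Z0x tightZ0 _]] := prune_tight hallF (noprune _ Fu0).
have [|Z /minsetP[/andP[Zx tightZ] minZ] _] :=
  @minset_exists _ [pred Z : {set I} | (x \in Z) && tight F Z] Z0.
  by rewrite /= Z0x.
have disj : [disjoint F x & \bigcup_(y in Z :\ x) F y].
  rewrite disjoint_subset; apply/subsetP=> u Fu; rewrite inE.
  have [Zu [Zux tightZu]] := prune_tight hallF (noprune _ Fu).
  apply: contra => /bigcupP[y /setD1P[neq_yx Zy] Fyu].
  apply/bigcupP; exists y => //; rewrite in_setD1 neq_yx.
  have ZI : Z :&: Zu = Z.
    by apply: minZ; rewrite ?subsetIl //= in_setI Zx Zux tightI.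
  by move: Zy; rewrite -ZI => /setIP[].
have := forallP hallF (Z :\ x); move: tightZ.
rewrite /tight (big_setD1 x Zx) /= [X in _ == X](big_setD1 x Zx) /=.
move: disj; rewrite -leq_card_setU => /eqP -> /eqP; lia.
Qed.

Lemma hall_demands F :
    hall_condition F ->
  exists H, [/\ forall x, H x \subset F x, forall x, #|H x| = d x
    & forall x y, x != y -> [disjoint H x & H y]].
Proof.
have [n] := ubnP (\sum_x #|F x|); elim: n F => // n IHn F ltF hallF.
case: (boolP [exists x, [exists (u | u \in F x), hall_condition (prune F x u)]]).
  move=> /existsP[x /existsP[u /andP[Fxu hallF']]].
  have [|H [subH cardH disjH]] := IHn (prune F x u) _ hallF'.
    rewrite ltnS in ltF; apply: leq_trans ltF.
    rewrite (bigD1 x) //= [X in _ < X](bigD1 x) //=.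
    rewrite -addSn {1}/prune eqxx (cardsD1 u (F x)) Fxu leq_add //.
    by apply: leq_sum => y _; apply/subset_leq_card/prune_sub.
  exists H; split=> // y.
  exact: subset_trans (subH y) (prune_sub _ _ _ _).
rewrite negb_exists => /forallP noprune; exists F.
have cardF x : #|F x| = d x.
  apply: pruned_card => // u Fu; have := noprune x.
  by rewrite negb_exists => /forallP/(_ u); rewrite Fu.
split=> // x y neq_xy; rewrite -leq_card_setU eqn_leq leq_card_setU /=.
have := forallP hallF [set x; y].
rewrite big_setU1 ?inE //= big_set1.
by rewrite bigcup_setU !big_set1 !cardF.
Qed.

End Hall.

(** * Attacks and defenses *)

Section Security.

Set Implicit Arguments.
Unset Strict Implicit.

Variables (T : finType) (e : rel T) (S : {set T}).
Hypothesis e_sym : symmetric e.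

Lemma cnbhd_sym x y : (x \in cnbhd e y) = (y \in cnbhd e x).
Proof. by rewrite !inE eq_sym e_sym. Qed.

Lemma bdry_has_border y : y \in bdry e S -> exists2 x, x \in Bord e S & e y x.
Proof.
case/setDP=> /bigcupP[x Sx xy] notSy; exists x.
  by rewrite inE Sx; apply/set0Pn; exists y; rewrite inE notSy.
move: xy; rewrite inE e_sym; case: eqP => // eq_yx.
by rewrite eq_yx Sx in notSy.
Qed.

Lemma mem_defense_dom x y :
  x \in Bord e S -> y \in S -> y \in cnbhd e x -> y \in defense_dom e S.
Proof. by move=> Bx Sy xy; rewrite inE Sy andbT; apply/bigcupP; exists x. Qed.

Lemma attack_fiber_sub A x :
  is_attack e S A -> fiber (bdry e S) A x \subset cnbhd e x :\: S.
Proof.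
move=> attA; apply/subsetP=> y; rewrite inE => /andP[By /eqP Ayx].
have [_] := attA y By; rewrite Ayx => eyx.
by case/setDP: By => _ notSy; rewrite !inE notSy e_sym eyx orbT.
Qed.

(** The worst case for a single border vertex: everybody who can attack [x]
    does so, and the others attack wherever they can. *)
Lemma attack_concentrated x :
    x \in Bord e S ->
  exists2 A, is_attack e S A & fiber (bdry e S) A x = cnbhd e x :\: S.
Proof.
move=> Bx; have Sx : x \in S by move: Bx; rewrite inE => /andP[].
pose A y := if e y x then x else odflt y [pick b in Bord e S | e y b].
have attA : is_attack e S A.
  move=> y /bdry_has_border[b Bb eyb]; rewrite /A.
  case: ifP => [-> // | _]; case: pickP => [c /andP[] // | /(_ b)].
  by rewrite Bb eyb.
exists A => //; apply/eqP; rewrite eqEsubset attack_fiber_sub //=.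
apply/subsetP=> y; rewrite inE => /andP[notSy xy].
have eyx : e y x.
  move: xy; rewrite inE e_sym; case: eqP => // eq_yx.
  by rewrite eq_yx Sx in notSy.
rewrite inE /A eyx eqxx andbT inE notSy.
by apply/bigcupP; exists x.
Qed.

(** The difference at [x] only involves the attackers of [x], so the worst
    attack may be chosen separately for each border vertex. *)
Lemma ultra_defenseP k D :
  ultra_defense e k S D <->
  is_defense e S D /\
  forall x, x \in Bord e S ->
    k + #|cnbhd e x :\: S| <= #|fiber (defense_dom e S) D x|.
Proof.
split=> -[defD ultD]; split=> //.
  move=> x Bx; have [A attA fibA] := attack_concentrated Bx.
  by have := ultD A attA x Bx; rewrite fibA; lia.
move=> A attA x Bx; have := ultD x Bx.
have := subset_leq_card (attack_fiber_sub x attA); lia.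
Qed.

(** Each defender is counted once, at the vertex it defends, hence the
    fibres over [X] together occupy at most [N[X] :&: S]. *)
Lemma defense_fibers_card D (X : {set T}) :
    is_defense e S D ->
  \sum_(x in X) #|fiber (defense_dom e S) D x| <= #|cnbhds e X :&: S|.
Proof.
move=> defD.
pose P := [set y in defense_dom e S | D y \in X].
have -> : \sum_(x in X) #|fiber (defense_dom e S) D x| = #|P|.
  rewrite -sum1_card [RHS](partition_big D (mem X)) /=; last first.
    by move=> y; rewrite /P inE => /andP[].
  apply: eq_bigr => x Xx; rewrite -sum1_card; apply: eq_bigl => y.
  by rewrite /P !inE; case: eqP => [->|]; rewrite ?Xx ?andbT ?andbF.
apply: subset_leq_card; apply/subsetP=> y; rewrite /P inE => /andP[domy XDy].
have [_ Dy] := defD y domy.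
case/setIP: domy => _ Sy; rewrite inE Sy andbT; apply/bigcupP; exists (D y) => //.
by rewrite cnbhd_sym inE; case: Dy => [->|->]; rewrite ?eqxx ?orbT.
Qed.

(** Vertices of the domain belonging to no squad are within reach of some
    border vertex, and sending them there only enlarges its fibre. *)
Lemma defense_of_squads (H : T -> {set T}) :
    (forall x, H x \subset cnbhd e x :&: S) ->
    (forall x y, x != y -> [disjoint H x & H y]) ->
  exists2 D, is_defense e S D
    & forall x, x \in Bord e S -> H x \subset fiber (defense_dom e S) D x.
Proof.
move=> subH disjH.
pose D y := if [pick x in Bord e S | y \in H x] is Some x then x
            else odflt y [pick x in Bord e S | y \in cnbhd e x].
have reach x y : y \in cnbhd e x -> x = y \/ e y x.
  by rewrite cnbhd_sym inE => /orP[/eqP|]; [left | right].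
exists D.
  move=> y /setIP[/bigcupP[b Bb yb] _]; rewrite /D.
  case: pickP => [x /andP[Bx Hxy] | _].
    by have /setIP[xy _] := subsetP (subH x) y Hxy; split; last exact: reach.
  case: pickP => [x /andP[Bx xy] | /(_ b)]; last by rewrite Bb yb.
  by split; last exact: reach.
move=> x Bx; apply/subsetP=> y Hxy.
have /setIP[xy Sy] := subsetP (subH x) y Hxy.
rewrite inE (mem_defense_dom Bx Sy xy) /D.
case: pickP => [z /andP[_ Hzy] | /(_ x)]; last by rewrite Bx Hxy.
apply: contraLR Hzy => neq_zx.
by rewrite (disjointFr (disjH x z _) Hxy) // eq_sym.
Qed.

End Security.

Theorem theorem2p6 (T : finType) (e : rel T) (k : nat) (S : {set T})
    (hG : simple_connected_graph e) (hk : k < max_degree e)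
    (hS : S != set0) :
  ultra_secure e k S <->
  (forall X : {set T}, X \subset Bord e S ->
     k * #|X| + \sum_(x in X) #|cnbhd e x :\: S| <= #|cnbhds e X :&: S|).
Proof.
have [e_sym _ _] := hG.
have sum_demand (X : {set T}) : k * #|X| + \sum_(x in X) #|cnbhd e x :\: S| =
    \sum_(x in X) (k + #|cnbhd e x :\: S|).
  by rewrite big_split /= sum_nat_const mulnC.
split=> [[_ [S_full | [D /(ultra_defenseP S e_sym)[defD ultD]]]] X subX | hallS].
- have -> : X = set0.
    apply/eqP; rewrite -subset0 (subset_trans subX) //; apply/subsetP=> x.
    by rewrite inE S_full setDT eqxx andbF.
  by rewrite cards0 big_set0 muln0.
- rewrite sum_demand; apply: leq_trans (defense_fibers_card e_sym X defD).
  by apply: leq_sum => x Xx; apply: ultD; apply: (subsetP subX).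
split=> //; right.
(* Vertices outside the border get demand 0, so that Hall's theorem applies to
   the whole vertex set. *)
pose d x := if x \in Bord e S then k + #|cnbhd e x :\: S| else 0.
have hallF : hall_condition d (fun x => cnbhd e x :&: S).
  apply/forallP=> X; rewrite -big_mkcondr /=.
  rewrite (eq_bigl (mem (X :&: Bord e S))); last by move=> x; rewrite !inE.
  rewrite -sum_demand (leq_trans (hallS _ (subsetIr _ _))) //.
  apply/subset_leq_card/subsetP=> y /setIP[/bigcupP[x /setIP[Xx _] xy] Sy].
  by apply/bigcupP; exists x; rewrite // inE xy.
have [H [subH cardH disjH]] := hall_demands hallF.
have [D defD subD] := defense_of_squads e_sym subH disjH.
exists D; apply/(ultra_defenseP S e_sym); split=> // x Bx.
by have := subset_leq_card (subD x Bx); rewrite cardH /d Bx.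
Qed.
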